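(* Fix a sample path of arrivals $(N_{t,\theta})_{t\in[T],\theta\in\Theta}$ and perishing times $(T_b)_{b\in\mathcal B}$. The allocation $X_{t,\theta}=B/N$ for all $t\in[T]$, $\theta\in\Theta$ is feasible under the hindsight optimal ordering if and only if the perishing process $(T_b)_{b\in\mathcal B}$ is offset-expiring, i.e. if and only if $$\frac{P_{<t}}{B}\le \frac{N_{<t}}{N}\qquad\text{for all } t\ge 2 .$$
   Context: Model. A decision-maker has a set $\mathcal B$ of $B$ divisible units of a single resource to allocate over rounds $t\in[T]=\{1,\dots,T\}$. In round $t$, $N_{t,\theta}\ge 1$ individuals of type $\theta$ arrive, for each $\theta$ in a finite type set $\Theta$; $N_t=\sum_{\theta}N_{t,\theta}$, $N=\sum_{t\in[T]}N_t$ and $N_{<t}=\sum_{t'<t}N_{t'}$. Unit $b\in\mathcal B$ has a perishing time $T_b\in\{1,2,\dots\}$: any part of it not allocated by the end of round $T_b$ (perishing occurs at the end of the round, after that round's allocation) spoils and can no longer be allocated. $P_t=\sum_{b\in\mathcal B}\mathbf 1\{T_b=t\}$ is the number of units perishing in period $t$ and $P_{<t}=\sum_{t'<t}P_{t'}$. An allocation $(X_{t,\theta})$ gives $X_{t,\theta}\ge 0$ units (fractional amounts allowed) to each of the $N_{t,\theta}$ individuals of type $\theta$ in round $t$. Units are handed out following a fixed ordering of $\mathcal B$: among units that are still (partly) unallocated and unspoiled, the one earliest in the ordering is used first. The hindsight optimal ordering is the ordering of units in increasing order of the realized perishing times $T_b$ (ties broken arbitrarily). An allocation is feasible (over a sample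 path) if it does not run out of budget, i.e. in every round the unspoiled, unallocated quantity available at the start of the round suffices to give every arriving individual the prescribed amount. *)

(* Defs.v *)
From HB Require Import structures.
From mathcomp Require Import all_boot all_order all_algebra.
Set Implicit Arguments.
Unset Strict Implicit.
Unset Printing Implicit Defensive.
Import Order.TTheory GRing.Theory Num.Theory.
Local Open Scope ring_scope.

(* Rounds are the naturals 1, ..., T. Arrival counts and allocations are
   functions on all of nat, but only their values on 1, ..., T are used. *)

Section Arrivals.
Variables (Theta : finType) (T : nat) (Narr : nat -> Theta -> nat).

Definition arrivals (t : nat) : nat := (\sum_(theta : Theta) Narr t theta)%N.

Definition total_arrivals : nat := (\sum_(1 <= t < T.+1) arrivals t)%N.

Definition arrivals_before (t : nat) : nat :=
  (\sum_(1 <= t' < T.+1 | (t' < t)%N) arrivals t')%N.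

End Arrivals.

Section Perishing.
Variables (U : finType) (Tb : U -> nat).

Definition perishing (t : nat) : nat := #|[set b : U | Tb b == t]|.

Definition perishing_before (t : nat) : nat :=
  (\sum_(1 <= t' < t) perishing t')%N.

(* An ordering lists every unit exactly once, the unit to be used first coming
   first; the order among units with equal perishing times is unconstrained. *)
Definition hindsight_optimal_ordering (order : seq U) : Prop :=
  perm_eq order (enum U) /\ sorted (fun b c => (Tb b <= Tb c)%N) order.

End Perishing.

Section Dynamics.
Variables (R : realFieldType) (Theta U : finType) (T : nat).
Variables (Narr : nat -> Theta -> nat) (Tb : U -> nat) (order : seq U).
Variable X : nat -> Theta -> R.

Definition demand (t : nat) : R :=
  \sum_(theta : Theta) (Narr t theta)%:R * X t theta.

(* [hand_out s d r] is what is left of each unit after an amount [d] has been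
   drawn from the quantities [r], exhausting the units in the order of [s]; if
   [r] does not cover [d], everything in [s] is used up. *)
Fixpoint hand_out (s : seq U) (d : R) (r : U -> R) : U -> R :=
  if s is b :: s' then
    let x := Num.min (r b) d in
    hand_out s' (d - x) (fun c => if c == b then r c - x else r c)
  else r.

Definition spoil (t : nat) (r : U -> R) : U -> R :=
  fun b => if (Tb b <= t)%N then 0 else r b.

(* Unspoiled, unallocated quantity of each unit after round [k], that is, at
   the start of round [k.+1]. *)
Fixpoint stock_after (k : nat) : U -> R :=
  if k is k'.+1 then spoil k (hand_out order (demand k) (stock_after k'))
  else fun=> 1.

Definition feasible : Prop :=
  forall t : nat, (1 <= t <= T)%N ->
    demand t <= \sum_(b : U) stock_after t.-1 b.

End Dynamics.

Definition offset_expiring (R : realFieldType) (Theta U : finType) (T : nat)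
    (Narr : nat -> Theta -> nat) (Tb : U -> nat) : Prop :=
  forall t : nat, (2 <= t)%N ->
    (perishing_before Tb t)%:R / #|U|%:R
      <= (arrivals_before T Narr t)%:R / (total_arrivals T Narr)%:R :> R.

(* Main.v *)
(** Write D_k for the total demand of the rounds 1, ..., k, so that D_T = B;
    offset-expiry says that at most D_k units perish by the end of each round
    k. If the allocation is feasible, then the stock left after round k covers
    the remaining demand B - D_k, while it is at most the number of units not
    perished by then. Conversely, as long as nothing has been lost, the units
    have been consumed in order from the front, by a total amount D_k; in the
    hindsight optimal ordering the units perishing by round k are among the
    first D_k ones, hence already used up, and again nothing is lost. *)

Require Import Defs.
From HB Require Import structures.
From mathcomp Require Import all_boot all_order all_algebra.
From mathcomp Require Import lra.
Set Implicit Arguments.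
Unset Strict Implicit.
Unset Printing Implicit Defensive.
Import Order.TTheory GRing.Theory Num.Theory.
Local Open Scope ring_scope.

(** * Drawing an amount from the units in order *)

Section HandOut.
Variables (R : realFieldType) (U : finType).
Implicit Types (s : seq U) (d : R) (r : U -> R).

Lemma hand_out_notin s d r b : b \notin s -> hand_out s d r b = r b.
Proof.
elim: s d r => [//|c s IHs] d r; rewrite inE negb_or => /andP[/negPf bc bs] /=.
by rewrite IHs // bc.
Qed.

Lemma hand_out_bounds s d r : 0 <= d -> (forall b, 0 <= r b) ->
  forall b, 0 <= hand_out s d r b <= r b.
Proof.
elim: s d r => [|c s IHs] d r d0 r0 b /=; first by rewrite r0 lexx.
have x0 : 0 <= Num.min (r c) d by rewrite le_min r0.
have xd : 0 <= d - Num.min (r c) d by rewrite subr_ge0 ge_min lexx orbT.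
have r'0 b' : 0 <= (if b' == c then r b' - Num.min (r c) d else r b').
  by case: eqP => [->|_] //; rewrite subr_ge0 ge_min lexx.
have /andP[-> /= h] := IHs _ _ xd r'0 b.
by apply: le_trans h _; case: ifP => // _; rewrite gerBl.
Qed.

Lemma sum_hand_out s d r : uniq s -> (forall b, 0 <= r b) ->
  0 <= d <= \sum_(b <- s) r b ->
  \sum_b hand_out s d r b = \sum_b r b - d.
Proof.
elim: s d r => [|c s IHs] d r /=.
  rewrite big_nil => _ _ d0; have -> : d = 0 by apply/eqP; rewrite eq_le andbC.
  by rewrite subr0.
move=> /andP[cs us] r0; rewrite big_cons => /andP[d0 dle].
set x := Num.min (r c) d; pose r' b := if b == c then r b - x else r b.
have r'0 b : 0 <= r' b.
  by rewrite /r'; case: eqP => [->|_] //; rewrite subr_ge0 ge_min lexx.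
have r's : \sum_(b <- s) r' b = \sum_(b <- s) r b.
  rewrite !big_seq; apply: eq_bigr => b bs; rewrite /r'.
  by case: eqP bs cs => [-> ->|].
have s0 : 0 <= \sum_(b <- s) r b by apply: sumr_ge0.
rewrite (IHs (d - x) r') // ?r's; last first.
  by rewrite /x; case: (leP (r c) d) => h; apply/andP; split; lra.
have -> : \sum_b r' b = \sum_b r b - x.
  rewrite (bigD1 c) //= [in RHS](bigD1 c) //= /r' eqxx.
  under eq_bigr => b /negPf -> do [].
  by rewrite addrAC.
by rewrite opprB subrKA.
Qed.

(* Quantity left of the [i]-th unit (from 0) once an amount [D] has been drawn
   from full units in order. *)
Definition remainder (D : R) (i : nat) : R :=
  Num.min 1 (Num.max 0 (i.+1%:R - D)).

Lemma remainder0 i : remainder 0 i = 1.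
Proof.
by rewrite /remainder subr0 max_r ?ler0n // min_l // ler1n.
Qed.

Lemma remainder_eq0 D i : i.+1%:R <= D -> remainder D i = 0.
Proof. by move=> h; rewrite /remainder max_l ?subr_le0 // min_r. Qed.

(** The first unit absorbs up to 1 of the drawn amount, and the units behind it see only the excess,
    truncated at 0 when [D] is below 1. *)
Lemma remainderS D i :
  remainder D i.+1 = remainder (Num.max (D - 1) 0) i.
Proof.
rewrite /remainder -natr1; have : 1 <= i.+1%:R :> R by rewrite ler1n.
move: i.+1%:R => n n1; case: (leP (D - 1) 0) => D1; last first.
  by rewrite opprB addrA.
by rewrite subr0 !max_r ?min_l //; lra.
Qed.

(** Successive draws add up, so the state of the units depends only on the total drawn. The
    induction peels off the first unit and replaces [D] by what the tail has already supplied. *)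
Lemma hand_out_remainder s D d r : uniq s -> 0 <= D -> 0 <= d ->
  {in s, forall b, r b = remainder D (index b s)} ->
  {in s, forall b, hand_out s d r b = remainder (D + d) (index b s)}.
Proof.
elim: s D d r => [//|c s IHs] D d r /= /andP[cs us] D0 d0 rE b.
have rc : r c = Num.max 0 (1 - D).
  rewrite rE ?mem_head // eqxx /remainder min_r // ge_max ler01 /=.
  by rewrite gerBl.
set x := Num.min (r c) d; pose r' b := if b == c then r b - x else r b.
have x0 : 0 <= d - x by rewrite subr_ge0 ge_min lexx orbT.
rewrite inE eq_sym; case: eqP => [<- _|/eqP cb /= bs].
  rewrite hand_out_notin //= eqxx /x rc /remainder [in RHS]min_r; last first.
    by rewrite ge_max ler01 /=; lra.
  case: (leP 0 (1 - D)) => D1; case: (leP 0 (1 - (D + d))) => Dd.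
  - by rewrite min_r; lra.
  - by rewrite min_l; lra.
  - by rewrite min_l; lra.
  - by rewrite min_l; lra.
(* The tail has supplied the excess of [D] over 1 and now supplies [d - x]; together these must be
   the excess of [D + d] over 1. *)
rewrite (IHs (Num.max (D - 1) 0) _ r') ?le_max ?lexx ?orbT //; last first.
  move=> b' b's; have cb' : (c == b') = false.
    by apply: contraNF cs => /eqP ->.
  by rewrite /r' eq_sym cb' rE ?inE ?b's ?orbT // cb' remainderS.
rewrite remainderS; congr remainder; rewrite /x rc.
case: (leP 0 (1 - D)) => D1; last by rewrite min_l ?max_l //; lra.
rewrite (max_r (_ : D - 1 <= 0)); last by lra.
by case: (leP (1 - D) d) => Dd; [rewrite max_l|rewrite max_r]; lra.
Qed.

End HandOut.

(** * Perished units and their place in the ordering *)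

Lemma perishing_beforeE (U : finType) (Tb : U -> nat) t :
  (forall b, 0 < Tb b)%N -> perishing_before Tb t = #|[set b | (Tb b < t)%N]|.
Proof.
move=> Tb0; elim: t => [|t IHt].
  rewrite /perishing_before big_geq //; apply/esym/eqP; rewrite cards_eq0.
  by apply/eqP/setP => b; rewrite !inE.
(* Periods start at 1, so the sum is still empty for bound 1; the set is empty there because
   perishing times are positive. *)
case: t IHt => [_|t IHt].
  rewrite /perishing_before big_geq //; apply/esym/eqP; rewrite cards_eq0.
  by apply/eqP/setP => b; rewrite !inE ltnS leqNgt Tb0.
rewrite /perishing_before big_nat_recr //= -/(perishing_before _ _) IHt.
rewrite /perishing -cardsUI [X in (_ + X)%N](_ : _ = 0)%N ?addn0; last first.
  apply/eqP; rewrite cards_eq0; apply/eqP/setP => b; rewrite !inE.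
  by case: ltngtP.
by apply: eq_card => b; rewrite !inE [RHS]ltnS [RHS]leq_eqVlt orbC.
Qed.

(** By sortedness, [b] and all units ahead of it perish no later than [b], hence before [t]; this
    prefix has [index b order + 1] members. *)
Lemma index_hindsight_optimal (U : finType) (Tb : U -> nat) order b t :
  hindsight_optimal_ordering Tb order -> (Tb b < t)%N ->
  (index b order < #|[set c | (Tb c < t)%N]|)%N.
Proof.
move=> [po so] bt.
have bo : b \in order by rewrite (perm_mem po) mem_enum.
have bs : (index b order < size order)%N by rewrite index_mem.
have -> : #|[set c | (Tb c < t)%N]| = count (fun c => Tb c < t)%N order.
  by rewrite cardsE cardE size_filter -enumT; apply/esym/permP.
rewrite -(cat_take_drop (index b order).+1 order) count_cat.
rewrite cat_take_drop; apply: leq_trans (leq_addr _ _).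
have sz : size (take (index b order).+1 order) = (index b order).+1.
  by rewrite size_takel.
rewrite -{1}sz; suff: all (fun c => Tb c < t)%N (take (index b order).+1 order).
  by rewrite all_count => /eqP ->.
apply/(all_nthP b) => i; rewrite sz => ilt; rewrite nth_take //.
apply: leq_ltn_trans bt; rewrite -{2}(nth_index b bo).
apply: (sorted_leq_nth (leT := fun b c => (Tb b <= Tb c)%N)) => //.
- by move=> x y z; apply: leq_trans.
- by rewrite inE (leq_ltn_trans _ bs).
Qed.

(** * Evolution of the stock *)

Section Stock.
Variables (R : realFieldType) (Theta U : finType) (T : nat).
Variables (Narr : nat -> Theta -> nat) (Tb : U -> nat) (order : seq U).
Variable X : nat -> Theta -> R.
Hypothesis X0 : forall t theta, 0 <= X t theta.
Hypothesis order_enum : perm_eq order (enum U).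

Let stock := stock_after Narr Tb order X.
Let demand := demand Narr X.

Lemma demand_ge0 t : 0 <= demand t.
Proof. by apply: sumr_ge0 => theta _; rewrite mulr_ge0. Qed.

Lemma order_uniq : uniq order.
Proof. by rewrite (perm_uniq order_enum) enum_uniq. Qed.

Lemma mem_order b : b \in order.
Proof. by rewrite (perm_mem order_enum) mem_enum. Qed.

Lemma sum_order (F : U -> R) : \sum_(b <- order) F b = \sum_b F b.
Proof. by rewrite (perm_big _ order_enum) big_enum. Qed.

Lemma stock_bounds k b : 0 <= stock k b <= 1.
Proof.
elim: k b => [|k IHk] b /=; first by rewrite ler01 lexx.
rewrite /stock /= /spoil; case: ifP => _; first by rewrite ler01 lexx.
have r0 c : 0 <= stock k c by have /andP[] := IHk c.
have /andP[-> h] := hand_out_bounds order (demand_ge0 k.+1) r0 b.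
by apply: le_trans h _; have /andP[] := IHk b.
Qed.

Lemma stock_ge0 k b : 0 <= stock k b.
Proof. by have /andP[] := stock_bounds k b. Qed.

(** Unit by unit, the stock plus the indicator of having perished is at most 1. *)
Lemma stock_le_unperished k :
  \sum_b stock k.+1 b <= #|U|%:R - #|[set b | (Tb b <= k.+1)%N]|%:R.
Proof.
rewrite lerBrDr -[#|[set _ | _]|]sum1_card -[#|U|]sum1_card !natr_sum.
rewrite [X in _ + X]big_mkcond -big_split /=.
apply: ler_sum => b _; rewrite inE.
have := stock_bounds k.+1 b; rewrite /stock /= /spoil.
by case: ifP => _ /andP[_ le1]; rewrite ?add0r ?addr0.
Qed.

Lemma sum_hand_out_stock k :
  demand k.+1 <= \sum_b stock k b ->
  \sum_b hand_out order (demand k.+1) (stock k) b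
    = \sum_b stock k b - demand k.+1.
Proof.
move=> h; apply: sum_hand_out; [exact: order_uniq|exact: stock_ge0|].
by rewrite demand_ge0 sum_order.
Qed.

Lemma sum_stockS k :
  demand k.+1 <= \sum_b stock k b ->
  \sum_b stock k.+1 b <= \sum_b stock k b - demand k.+1.
Proof.
move=> /sum_hand_out_stock <-; apply: ler_sum => b _.
rewrite /stock /= /spoil; case: ifP => // _.
by have /andP[] := hand_out_bounds order (demand_ge0 k.+1) (stock_ge0 k) b.
Qed.

(** Backward induction from round [T]: serving round [k + 1] leaves at least the next stock, which
    already covers the later rounds. *)
Lemma feasible_stock k : feasible T Narr Tb order X -> (k <= T)%N ->
  \sum_(k <= t < T) demand t.+1 <= \sum_b stock k b.
Proof.
move=> feas kT; rewrite -(subKn kT); move: (T - k)%N (leq_subr k T).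
elim=> [_|j IHj jT].
  by rewrite subn0 big_geq //; apply: sumr_ge0 => b _; apply: stock_ge0.
have TjE : (T - j = (T - j.+1).+1)%N by rewrite subnSK.
rewrite big_ltn; last by rewrite -TjE leq_subr.
have lt : (1 <= (T - j.+1).+1 <= T)%N by rewrite -TjE leq_subr TjE.
have := sum_stockS (feas _ lt); have := IHj (ltnW jT).
by rewrite TjE => h1 h2; lra.
Qed.

(** Here [D] is the cumulative demand. If it stays within the budget and dominates the number of
    perished units, nothing is lost and the stock is known exactly. *)
Lemma stock_remainder (D : nat -> R) :
  hindsight_optimal_ordering Tb order ->
  D 0%N = 0 ->
  (forall k, (k < T)%N -> D k.+1 = D k + demand k.+1) ->
  (forall k, (k < T)%N -> D k.+1 <= #|U|%:R) ->
  (forall k, (k < T)%N -> #|[set b | (Tb b <= k.+1)%N]|%:R <= D k.+1) ->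
  forall k, (k <= T)%N ->
  0 <= D k /\ (forall b, stock k b = remainder (D k) (index b order)) /\
  \sum_b stock k b = #|U|%:R - D k.
Proof.
move=> ho D0 DS DB DP; elim=> [_|k IHk kT].
  rewrite D0; split=> //; split; first by move=> b; rewrite remainder0.
  by rewrite subr0 sumr_const.
have [Dk0 [stE sumE]] := IHk (ltnW kT).
have dle : demand k.+1 <= \sum_b stock k b.
  by have := DB _ kT; rewrite DS // sumE; lra.
have hE b : hand_out order (demand k.+1) (stock k) b
    = remainder (D k.+1) (index b order).
  rewrite DS //; apply: hand_out_remainder; rewrite ?demand_ge0 ?mem_order //.
  exact: order_uniq.
(* Spoilage removes nothing: a unit perishing by round [k + 1] lies among the first [D k.+1] units,
   so it is already exhausted. *)
have sE b : stock k.+1 b = hand_out order (demand k.+1) (stock k) b.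
  rewrite {1}/stock /= /spoil; case: ifP => // bk.
  apply/esym; rewrite -/demand -/stock hE remainder_eq0 //.
  apply: le_trans (DP _ kT); rewrite ler_nat.
  exact: (index_hindsight_optimal (t := k.+2) ho).
split; first by rewrite DS // addr_ge0 ?demand_ge0.
split=> [b|]; first by rewrite sE hE.
by under eq_bigr do rewrite sE; rewrite sum_hand_out_stock // sumE DS //; lra.
Qed.

End Stock.

(** * Cumulative arrivals and the equivalence *)

Lemma arrivals_before_le (Theta : finType) T (Narr : nat -> Theta -> nat) k :
  (k <= T)%N ->
  arrivals_before T Narr k.+1 = (\sum_(0 <= t < k) arrivals Narr t.+1)%N.
Proof.
move=> kT; rewrite /arrivals_before -(big_add1 _ _ 0 k.+1 xpredT).
by rewrite [RHS](big_nat_widen _ _ T.+1).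
Qed.

Lemma arrivals_before_total (Theta : finType) T (Narr : nat -> Theta -> nat) t :
  (T < t)%N -> arrivals_before T Narr t = total_arrivals T Narr.
Proof.
move=> Tt; rewrite /arrivals_before /total_arrivals.
rewrite big_nat_cond [RHS]big_nat_cond; apply: eq_bigl => i.
rewrite andbT; case: (ltnP i T.+1) => iT; rewrite ?andbF //.
by rewrite (leq_ltn_trans _ Tt) // andbT.
Qed.

Theorem theorem2 (R : realFieldType) (Theta U : finType) (T : nat)
    (Narr : nat -> Theta -> nat) (Tb : U -> nat) (order : seq U)
    (hT : (0 < T)%N) (hTheta : (0 < #|Theta|)%N) (hU : (0 < #|U|)%N)
    (hNarr : forall (t : nat) (theta : Theta),
       (1 <= t <= T)%N -> (1 <= Narr t theta)%N)
    (hTb : forall b : U, (1 <= Tb b)%N)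
    (horder : hindsight_optimal_ordering Tb order) :
  feasible T Narr Tb order
    (fun (_ : nat) (_ : Theta) => #|U|%:R / (total_arrivals T Narr)%:R : R)
  <-> offset_expiring R T Narr Tb.
Proof.
set N := total_arrivals T Narr; set a : R := #|U|%:R / N%:R.
set X := fun _ _ => a.
have N0 : (0 < N)%N.
  have /card_gt0P[theta _] := hTheta.
  rewrite /N /total_arrivals big_ltn // ltn_addr // /arrivals (bigD1 theta) //=.
  by rewrite ltn_addr // hNarr.
have NR0 : 0 < N%:R :> R by rewrite ltr0n.
have UR0 : 0 < #|U|%:R :> R by rewrite ltr0n.
have a0 : 0 <= a by rewrite divr_ge0.
have X0 t theta : 0 <= X t theta by [].
have demE t : demand Narr X t = (arrivals Narr t)%:R * a.
  by rewrite /demand /arrivals natr_sum mulr_suml.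
(* The shift to [k.+1] makes round [k] itself count, as [arrivals_before] is strict. *)
pose D k : R := (arrivals_before T Narr k.+1)%:R * a.
have DE k : (k <= T)%N -> D k = \sum_(0 <= t < k) demand Narr X t.+1.
  move=> kT; rewrite /D arrivals_before_le // natr_sum mulr_suml.
  by apply: eq_bigr => t _; rewrite demE.
have DT : D T = #|U|%:R.
  by rewrite /D arrivals_before_total // mulrC divfK // gt_eqF.
have offE k : ((perishing_before Tb k.+1)%:R / #|U|%:R
      <= (arrivals_before T Narr k.+1)%:R / N%:R :> R)
    = (#|[set b | (Tb b <= k)%N]|%:R <= D k).
  rewrite perishing_beforeE // ler_pdivrMr // /D /a mulrCA mulrC mulrA.
  by rewrite [X in _ <= X / _]mulrC -mulrA.
split=> [feas t|off].
  case: t => [//|[//|k]] _; rewrite offE.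
  (* Offset-expiry also speaks of times beyond the horizon; there the whole budget is demanded,
     which bounds any number of units. *)
  have [kT|Tk] := leqP k.+1 T; last first.
    rewrite /D arrivals_before_total ?(ltn_trans Tk) //.
    by rewrite mulrC divfK ?gt_eqF // ler_nat max_card.
  have := feasible_stock X0 horder.1 feas kT.
  have := stock_le_unperished Narr Tb order X0 k.
  have := DT; rewrite !DE // (big_cat_nat (leq0n k.+1) kT) //=.
  by move=> h1 h2 h3; lra.
have DS k : (k < T)%N -> D k.+1 = D k + demand Narr X k.+1.
  by move=> kT; rewrite (DE _ kT) (DE _ (ltnW kT)) big_nat_recr.
have DB k : (k <= T)%N -> D k <= #|U|%:R.
  move=> kT; rewrite -DT !DE // (big_cat_nat (leq0n k) kT) //= lerDl.
  by apply: sumr_ge0 => t _; apply: demand_ge0.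
case=> [//|k] /= kT.
have D0 : D 0%N = 0 by rewrite DE // big_geq.
have DP j : (j < T)%N -> #|[set b | (Tb b <= j.+1)%N]|%:R <= D j.+1.
  by move=> _; rewrite -offE; apply: off.
have DBS j : (j < T)%N -> D j.+1 <= #|U|%:R by apply: DB.
(* With stock exactly [#|U| - D k], feasibility in round [k + 1] amounts to [D k.+1 <= #|U|]. *)
have [_ [_ ->]] := stock_remainder X0 horder.1 horder D0 DS DBS DP (ltnW kT).
by have := DB _ kT; rewrite DS //; lra.
Qed.
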